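(* Every real Banach space $X$ has property (N2): the relative norm interior (in $B_X$) of each convex combination of slices of $B_X$ is not empty.
   Context: All Banach spaces are real. $B_X$ and $S_X$ denote the closed unit ball and the unit sphere of $X$, and $X^*$ is the topological dual. A slice of $B_X$ is a set $S(B_X,f,\alpha):=\{x\in B_X: f(x)>1-\alpha\}$ with $f\in S_{X^*}$ and $\alpha>0$. A convex combination of slices of $B_X$ is a set $\sum_{i=1}^n\lambda_i S_i$ (Minkowski sum), where $\lambda_1,\dots,\lambda_n\in[0,1]$, $\sum_{i=1}^n\lambda_i=1$, and each $S_i$ is a slice of $B_X$. *)

(* Defs.v *)
From HB Require Import structures.
From mathcomp Require Import all_boot all_order all_algebra.
From mathcomp Require Import all_classical all_reals all_analysis.

Set Implicit Arguments.
Unset Strict Implicit.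
Unset Printing Implicit Defensive.
Import Order.TTheory GRing.Theory Num.Theory.
Import numFieldNormedType.Exports.

Local Open Scope classical_set_scope.
Local Open Scope ring_scope.

Definition unit_ball (R : realType) (X : normedModType R) : set X :=
  [set x | `|x| <= 1].
Arguments unit_ball {R} X.

(* [sup] is 0 on sets without an upper bound; this is harmless here, since
   [dual_norm] is only used for continuous, hence bounded, functionals. *)
Definition dual_norm (R : realType) (X : normedModType R)
    (f : {linear X -> R^o}) : R :=
  sup [set `|f x| | x in unit_ball X].

Definition dual_unit_sphere (R : realType) (X : normedModType R) :
    set {linear X -> R^o} :=
  [set f : {linear X -> R^o} | continuous f /\ dual_norm f = 1].
Arguments dual_unit_sphere {R} X.

Definition slice (R : realType) (X : normedModType R)
    (f : {linear X -> R^o}) (alpha : R) : set X :=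
  [set x | unit_ball X x /\ 1 - alpha < f x].

Definition is_slice (R : realType) (X : normedModType R) (S : set X) : Prop :=
  exists (f : {linear X -> R^o}) (alpha : R),
    [/\ dual_unit_sphere X f, 0 < alpha & S = slice f alpha].

Definition weighted_minkowski_sum (R : realType) (X : normedModType R) (n : nat)
    (lambda : 'I_n -> R) (S : 'I_n -> set X) : set X :=
  [set x | exists2 s : 'I_n -> X,
     (forall i, S i (s i)) & x = \sum_(i < n) lambda i *: s i].

(* The case n = 0 is excluded by the condition on the sum of the weights. *)
Definition is_convex_combination_of_slices (R : realType) (X : normedModType R)
    (C : set X) : Prop :=
  exists (n : nat) (lambda : 'I_n -> R) (S : 'I_n -> set X),
    [/\ forall i, 0 <= lambda i <= 1,
        \sum_(i < n) lambda i = 1,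
        forall i, is_slice (S i) &
        C = weighted_minkowski_sum lambda S].

(* [subspace A] is the whole carrier, with the points outside [A] isolated;
   the intersection with [A] discards those points. *)
Definition relative_interior (T : topologicalType) (A C : set T) : set T :=
  A `&` interior (C : set (subspace A)).

Definition property_N2 (R : realType) (X : normedModType R) : Prop :=
  forall C : set X, is_convex_combination_of_slices C ->
    relative_interior (unit_ball X) C !=set0.

(* Main.v *)
Require Import Defs.
From mathcomp Require Import all_boot all_order all_algebra.
From mathcomp Require Import all_classical all_reals all_analysis.
From mathcomp Require Import ring lra.

(** Slices of the unit ball are thick: since the functional has norm one, some
    point of the closed ball strictly satisfies the inequality defining the
    slice, and shrinking it slightly towards the origin moves it into the open
    ball without violating that strict inequality ([slice_open_point]).  The
    open ball intersected with the open half-space is then a norm neighbourhood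
    of that point inside the slice ([slice_nbhs]).

    A convex combination of such sets inherits this: choose an inner point
    [s i] in each slice and a weight [lambda j] that is not zero.  Moving only
    the [j]-th summand sweeps out a whole neighbourhood of the combined point
    ([weighted_minkowski_sum_nbhs]).  The combined point lies in the unit ball
    by convexity, and a neighbourhood in the whole space is a fortiori one
    relative to the ball. *)

Set Implicit Arguments.
Unset Strict Implicit.
Unset Printing Implicit Defensive.
Import Order.TTheory GRing.Theory Num.Theory.
Import numFieldNormedType.Exports.

Local Open Scope classical_set_scope.
Local Open Scope ring_scope.

Section SlicesAndSums.
Variables (R : realType) (X : normedModType R).

(** Room is left between [b] and [a] to shrink [a] by a factor below one; if
    [a] is not positive, the factor zero already works. *)
Lemma shrink_above (a b : R) : b < a -> exists2 t, 0 <= t < 1 & b < t * a.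
Proof.
move=> ba; have [a0|a0] := leP a 0.
  by exists 0; [lra | rewrite mul0r; lra].
(* this factor sends [a] to the midpoint of [b] and [a], unless that midpoint
   is negative *)
exists (Num.max 0 ((b + a) / (2 * a))).
  rewrite le_max lexx /= gt_max ltr01 /= ltr_pdivrMr; lra.
apply: (@lt_le_trans _ _ ((b + a) / (2 * a) * a)).
  have -> : (b + a) / (2 * a) * a = (b + a) / 2 by field; rewrite gt_eqF.
  lra.
by rewrite ler_pM2r// le_max lexx orbT.
Qed.

Lemma slice_open_point (f : {linear X -> R^o}) (alpha : R) :
  dual_norm f = 1 -> 0 < alpha -> exists2 x, `|x| < 1 & 1 - alpha < f x.
Proof.
move=> f1 alpha0.
pose V : set R := [set `|f x| | x in unit_ball X].
have supV : has_sup V.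
  (* an unbounded set would have the default supremum 0 instead of 1 *)
  apply: contrapT => /sup_out supV0.
  move: f1 supV0; rewrite /dual_norm -/V => ->.
  by move/eqP; rewrite oner_eq0.
have [_ [x x1 <-]] := sup_adherent alpha0 supV.
rewrite -/(dual_norm f) f1 => fx.
(* the dual norm only controls [`|f x|]; the symmetry of the ball fixes the sign *)
have [z z1 fz] : exists2 z, `|z| <= 1 & 1 - alpha < f z.
  have [f0|f0] := leP 0 (f x).
    by exists x => //; move: fx; rewrite ger0_norm.
  by exists (- x); [rewrite normrN | rewrite linearN -(ltr0_norm f0)].
have [t /andP[t0 t1] tfz] := shrink_above fz.
exists (t *: z); last by rewrite linearZ.
rewrite normrZ ger0_norm//; apply: le_lt_trans t1.
by rewrite ler_piMr.
Qed.

Lemma slice_nbhs (S : set X) : is_slice S -> exists x : X, nbhs x S.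
Proof.
move=> [f [alpha [[fc f1] alpha0 ->]]].
have [x x1 fx] := slice_open_point f1 alpha0.
exists x.
have nx : \forall y \near x, `|y| < 1.
  exact: (@cvgr_lt _ _ _ _ _ _ (@norm_continuous _ X x)).
have fy : \forall y \near x, 1 - alpha < f y.
  exact: (@cvgr_gt _ _ _ _ f _ (fc x)).
by apply: filterS2 nx fy => y /ltW.
Qed.

(** Near the combined point, the whole displacement can be absorbed by the
    [j]-th summand, after division by its weight. *)
Lemma weighted_minkowski_sum_nbhs (n : nat) (lambda : 'I_n -> R)
    (S : 'I_n -> set X) (s : 'I_n -> X) (j : 'I_n) :
  lambda j != 0 -> (forall i, S i (s i)) -> nbhs (s j) (S j) ->
  nbhs (\sum_(i < n) lambda i *: s i) (weighted_minkowski_sum lambda S).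
Proof.
move=> lj Ss Sj; set y := \sum_(i < n) _.
pose g (z : X) := s j + (lambda j)^-1 *: (z - y).
have gy : g z @[z --> y] --> s j.
  rewrite -[X in _ --> X]addr0 -(scaler0 _ (lambda j)^-1) -(subrr y).
  by apply: cvgD; [exact: cvg_cst | apply: cvgZr; apply: cvgB;
    [exact: cvg_id | exact: cvg_cst]].
have : \forall z \near y, S j (g z) by exact: gy.
apply: filterS => z Sgz.
exists (fun i => if i == j then g z else s i) => [i|].
  by case: eqP => [->|].
rewrite (bigD1 j)//= eqxx (eq_bigr (fun i => lambda i *: s i)); last first.
  by move=> i /negbTE ->.
rewrite /g scalerDr scalerA divff// scale1r addrAC.
have <- : y = lambda j *: s j + \sum_(i < n | i != j) lambda i *: s i.
  by rewrite /y (bigD1 j).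
by rewrite addrC subrK.
Qed.

Lemma unit_ball_convex_sum (n : nat) (lambda : 'I_n -> R) (s : 'I_n -> X) :
  (forall i, 0 <= lambda i) -> \sum_(i < n) lambda i = 1 ->
  (forall i, unit_ball X (s i)) -> unit_ball X (\sum_(i < n) lambda i *: s i).
Proof.
move=> l0 l1 s1; rewrite /unit_ball /= -l1.
apply: le_trans (ler_norm_sum _ _ _) _; apply: ler_sum => i _.
by rewrite normrZ ger0_norm// ler_piMr//; exact: s1.
Qed.

Lemma nbhs_relative_interior (T : topologicalType) (A C : set T) (x : T) :
  A x -> nbhs x C -> relative_interior A C x.
Proof.
move=> Ax Cx; split=> //.
suff : nbhs_subspace (x : subspace A) C by [].
by rewrite -(nbhs_subspace_in Ax); apply: filterS Cx.
Qed.

End SlicesAndSums.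

Theorem corollary2p2 (R : realType) (X : completeNormedModType R) :
  property_N2 X.
Proof.
move=> C [n [lambda [S [l01 l1 slS ->]]]].
have l0 i : 0 <= lambda i by case/andP: (l01 i).
have [s Ss] := choice (fun i => slice_nbhs (slS i)).
have Sin i : S i (s i) := nbhs_singleton (Ss i).
have [j lj] : exists j, lambda j != 0.
  apply: contrapT => /forallNP l_eq0; move/eqP: l1.
  rewrite big1 ?[0 == 1]eq_sym ?oner_eq0// => i _.
  by apply/eqP/negPn/negP; exact: l_eq0.
exists (\sum_(i < n) lambda i *: s i); apply: nbhs_relative_interior.
  apply: unit_ball_convex_sum => // i.
  by have [f [alpha [_ _ Si]]] := slS i; move: (Sin i); rewrite Si => -[].
exact: (weighted_minkowski_sum_nbhs lj Sin (Ss j)).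
Qed.
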